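(* Let $E$ be a Banach space and let $(y_n)_{n\ge1}$ be any weakly convergent sequence in $E$, with weak limit $y$. Then there is a function $\varphi : \mathbb{N} \to \mathbb{N}$ such that the sequence $x_n = y_{\varphi(n)}$, $n \ge 1$, is Cesàro summable to $y$, that is, $\frac{x_1 + \dots + x_N}{N} \to y$ in norm as $N \to \infty$.
   Context: Banach spaces are real. *)

(* Defs.v *)
From mathcomp Require Import all_boot all_order all_algebra.
From mathcomp Require Import all_classical all_reals all_analysis.

Set Implicit Arguments.
Unset Strict Implicit.
Unset Printing Implicit Defensive.

Import GRing.Theory Num.Theory.
Import numFieldNormedType.Exports.

Local Open Scope classical_set_scope.
Local Open Scope ring_scope.

(* Sequences (u_n)_{n >= 1} are represented by functions on [nat]; the value
   at 0 is irrelevant to both definitions below. *)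

(* [R^o] is [R] as a normed module over itself, so [f] ranges over the
   topological dual of [E]. *)
Definition weakly_cvg_to (R : realType) (E : normedModType R)
    (u : nat -> E) (l : E) : Prop :=
  forall f : {linear E -> R^o}, continuous f -> f (u n) @[n --> \oo] --> f l.

Definition cesaro_mean (R : realType) (E : normedModType R)
    (u : nat -> E) (N : nat) : E :=
  N%:R^-1 *: \sum_(1 <= n < N.+1) u n.

Definition cesaro_summable_to (R : realType) (E : normedModType R)
    (u : nat -> E) (l : E) : Prop :=
  cesaro_mean u N @[N --> \oo] --> l.

(* Main.v *)
Require Import Defs.
From HB Require Import structures.
From mathcomp Require Import all_boot all_order all_algebra.
From mathcomp Require Import all_classical all_reals all_analysis.
From mathcomp Require Import ring lra.

(** Put [z n = y n.+1 - l], a weakly null sequence.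

    Only averages with repetitions matter, so the relevant form of Mazur's
    theorem is: for every [d > 0] some nonempty finite word [s] of indices has
    [`|\sum_(i <- s) z i| < d * size s] ([weakly_null_small_average]).  If not,
    every finite sum of [size s] terms has norm at least [d * size s], and a
    Hahn-Banach argument gives a continuous linear functional [F] with
    [d <= F (z n)] for all [n], against [F (z n) --> 0].  Since words carry
    integer multiplicities only, it is convenient to apply Hahn-Banach to the
    additive group of the space ([hahn_banach_group]): the functional obtained
    is merely additive, and real homogeneity follows from domination by the norm
    ([additive_le_norm_dual]).

    Take for each [j] such a word [s j] with [d = 1 / j.+1] and repeat it
    periodically.  The Cesaro means of the resulting sequence tend to the average
    [a j] over one period, with partial sums deviating from [N] times [a j] by a
    bounded amount ([periodic_bounded_discrepancy]), and [a j --> 0].  The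
    sequence sought reads at time [n] the [n]-th letter of the periodic sequence
    number [k n], where [k] tends to infinity so slowly that all the deviations
    accumulated up to time [N], including those caused by switching from one
    periodic sequence to the next, are at most [N / k N]
    ([splice_cesaro_null]). *)

Set Implicit Arguments.
Unset Strict Implicit.
Unset Printing Implicit Defensive.

Import Order.TTheory GRing.Theory Num.Theory.
Import numFieldNormedType.Exports.

Local Open Scope classical_set_scope.
Local Open Scope ring_scope.

(** * A Hahn-Banach theorem for abelian groups *)

(** The group analogue of a sublinear functional.  Subadditivity gives the
    converse of the second inequality for [k > 0]; the case [k = 0] forces
    [0 <= q 0]. *)
Definition group_sublinear (R : realType) (V : zmodType) (q : V -> R) : Prop :=
  (forall x y, q (x + y) <= q x + q y) /\ (forall x k, q x *+ k <= q (x *+ k)).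

Lemma group_sublinear0 (R : realType) (V : zmodType) (q : V -> R) :
  group_sublinear q -> q 0 = 0.
Proof.
move=> [_ qM]; have := qM 0 0%N; have := qM 0 2%N.
by rewrite !mul0rn !mulr0n mulr2n; lra.
Qed.

Lemma group_sublinear_geN (R : realType) (V : zmodType) (q : V -> R) (x : V) :
  group_sublinear q -> - q (- x) <= q x.
Proof.
move=> sq; have := sq.1 x (- x).
by rewrite subrr (group_sublinear0 sq); lra.
Qed.

Lemma group_sublinearMn (R : realType) (V : zmodType) (q : V -> R) (x : V) k :
  group_sublinear q -> q (x *+ k) = q x *+ k.
Proof.
move=> sq; apply/le_anti/andP; split; last exact: sq.2.
elim: k => [|k ih]; first by rewrite !mulr0n group_sublinear0.
by rewrite mulrS (mulrS (q x)) (le_trans (sq.1 _ _))// lerD2l.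
Qed.

Lemma inf_image_le (R : realType) (I : Type) (A : set I) (g : I -> R) (b : R)
    (i : I) :
  (forall j, A j -> b <= g j) -> A i -> inf [set g j | j in A] <= g i.
Proof.
move=> bg Ai; apply: ge_inf; last by exists i.
by exists b => _ [j Aj <-]; exact: bg.
Qed.

Lemma le_inf_image (R : realType) (I : Type) (A : set I) (g : I -> R) (b : R)
    (i : I) :
  A i -> (forall j, A j -> b <= g j) -> b <= inf [set g j | j in A].
Proof.
move=> Ai bg; apply: lb_le_inf; first by exists (g i), i.
by move=> _ [j Aj <-]; exact: bg.
Qed.

(** The pointwise infimum of the chain works: it is finite because
    [- p (- x) <= q x] for every [q] in the chain, and subadditive because two
    members of a chain are comparable. *)
Lemma group_sublinear_chain_lbound (R : realType) (V : zmodType) (p : V -> R)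
    (A : set (V -> R)) (q0 : V -> R) :
  A q0 ->
  (forall q, A q -> group_sublinear q /\ forall x, q x <= p x) ->
  (forall q q', A q -> A q' ->
    (forall x, q x <= q' x) \/ (forall x, q' x <= q x)) ->
  exists m : V -> R, group_sublinear m /\ forall q, A q -> forall x, m x <= q x.
Proof.
move=> Aq0 Asub tot.
have lb x q : A q -> - p (- x) <= q x.
  move=> Aq; have [sq qp] := Asub _ Aq.
  by rewrite (le_trans _ (group_sublinear_geN x sq))// lerN2.
have inf_leq x q : A q -> inf [set q x | q in A] <= q x.
  by move=> Aq; apply: (@inf_image_le _ _ A (fun q : V -> R => q x)) (lb x) Aq.
have leq_inf x b : (forall q, A q -> b <= q x) -> b <= inf [set q x | q in A].
  exact: (@le_inf_image _ _ A (fun q : V -> R => q x) b q0 Aq0).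
exists (fun x => inf [set q x | q in A]).
split; last by move=> q Aq x; exact: inf_leq.
split=> [x y|x k]; last first.
  apply: (leq_inf) => q Aq; apply: le_trans ((Asub _ Aq).1.2 x k).
  by rewrite lerMn2r inf_leq ?orbT.
(* The larger of two members of the chain may be replaced by the smaller. *)
rewrite -lerBlDr; apply: (leq_inf) => q Aq; rewrite lerBlDr [leRHS]addrC -lerBlDr.
apply: (leq_inf) => q' Aq'; rewrite lerBlDr.
have [qq'|q'q] := tot _ _ Aq Aq'.
  apply: (le_trans (inf_leq _ _ Aq)); apply: (le_trans ((Asub _ Aq).1.1 x y)).
  by rewrite addrC lerD2r.
apply: (le_trans (inf_leq _ _ Aq')); apply: (le_trans ((Asub _ Aq').1.1 x y)).
by rewrite addrC lerD2l.
Qed.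

(** Zorn's lemma for the reversed pointwise order. *)
Lemma group_sublinear_minimal (R : realType) (V : zmodType) (p : V -> R) :
  group_sublinear p ->
  exists q : V -> R, [/\ group_sublinear q, (forall x, q x <= p x) &
    forall q', group_sublinear q' -> (forall x, q' x <= q x) -> q' = q].
Proof.
move=> sp.
pose P (q : V -> R) := group_sublinear q /\ forall x, q x <= p x.
pose T := {q : V -> R | P q}.
pose ge (a b : T) := `[< forall x, sval b x <= sval a x >].
have [||||[q [sq qp]] qmin] := @Zorn T ge.
- by move=> a; apply/asboolP.
- move=> b a c /asboolP ab /asboolP bc; apply/asboolP => x.
  exact: le_trans (bc x) (ab x).
- move=> [a Pa] [b Pb] /asboolP ab /asboolP ba; apply: eq_exist.
  by apply/funext => x; apply/le_anti/andP; split; [exact: ba|exact: ab].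
- move=> A totA; have [[a0 Aa0]|A0] := pselect (A !=set0); last first.
    by exists (exist _ p (conj sp (fun x => lexx _))) => s As; case: A0; exists s.
  pose B := [set sval a | a in A].
  have Bsub q : B q -> P q by case=> a _ <-; exact: svalP.
  have Ba0 : B (sval a0) by exists a0.
  have Btot q q' : B q -> B q' ->
      (forall x, q x <= q' x) \/ (forall x, q' x <= q x).
    move=> [a Aa <-] [b Ab <-].
    by have [/asboolP|/asboolP] := totA _ _ Aa Ab; [right|left].
  have [m [sm mle]] := group_sublinear_chain_lbound Ba0 Bsub Btot.
  have Pm : P m by split=> // x; exact: le_trans (mle _ Ba0 x) ((Bsub _ Ba0).2 x).
  exists (exist _ _ Pm) => a Aa; apply/asboolP => x /=.
  by apply: mle; exists a.
exists q; split=> // q' sq' q'q.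
have Pq' : P q' by split=> // x; exact: le_trans (q'q x) (qp x).
exact: (congr1 sval (qmin (exist _ _ Pq') (asboolT q'q))).
Qed.

(** The infimum over [n] of [q (x + y *+ n) - q y *+ n] is again sublinear.  Hence
    a minimal [q] satisfies [q x <= q (x + y) - q y] for all [x] and [y]. *)
Lemma group_sublinear_slide (R : realType) (V : zmodType) (q : V -> R) (y : V) :
  group_sublinear q ->
  exists q' : V -> R, [/\ group_sublinear q', (forall x, q' x <= q x) &
    forall x, q' x <= q (x + y) - q y].
Proof.
move=> sq; pose g x n := q (x + y *+ n) - q y *+ n.
have lb x n : - q (- x) <= g x n.
  have := sq.1 (x + y *+ n) (- x); rewrite addrAC subrr add0r.
  by have := sq.2 y n; rewrite /g; lra.
pose q' x := inf [set g x n | n in [set: nat]].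
have q'_le x n : q' x <= g x n.
  exact: (@inf_image_le _ _ _ (g x)) (fun n _ => lb x n) _.
have le_q' x b : (forall n, b <= g x n) -> b <= q' x.
  by move=> h; apply: (@le_inf_image _ _ _ (g x) b 0%N) => // n _; exact: h.
exists q'; split=> [|x|x]; last 2 first.
- by have := q'_le x 0%N; rewrite /g !mulr0n addr0 subr0.
- by have := q'_le x 1%N; rewrite /g !mulr1n.
split=> [x x'|x k].
  rewrite -lerBlDr; apply: (le_q') => n; rewrite lerBlDr [leRHS]addrC -lerBlDr.
  apply: (le_q') => m; rewrite lerBlDr; apply: (le_trans (q'_le _ (m + n)%N)).
  have := sq.1 (x + y *+ n) (x' + y *+ m).
  by rewrite addrACA -mulrnDr /g (addnC m) (mulrnDr (q y)); lra.
apply: (le_q') => n; case: k => [|k].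
  by rewrite /g !mulr0n add0r subr_ge0; exact: sq.2.
apply: (@le_trans _ _ (g x n *+ k.+1)); first by rewrite lerMn2r q'_le.
rewrite /g mulrnBl -(group_sublinearMn (x + _) k.+1 sq) mulrnDl.
rewrite (mulrS (y *+ n)) addrA.
have := sq.1 (x *+ k.+1 + y *+ n) (y *+ n *+ k).
by rewrite !(group_sublinearMn _ _ sq) (mulrS (q y *+ n)); lra.
Qed.

(** A minimal sublinear functional below [p] is additive, so that no extension
    of partially defined functionals is needed. *)
Lemma hahn_banach_group (R : realType) (V : zmodType) (p : V -> R) :
  group_sublinear p ->
  exists f : V -> R, (forall x y, f (x + y) = f x + f y) /\ forall x, f x <= p x.
Proof.
move=> /group_sublinear_minimal[q [sq qp qmin]]; exists q; split=> // x y.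
apply/le_anti; rewrite sq.1/=.
have [q' [sq' q'q q'y]] := group_sublinear_slide y sq.
by have := q'y x; rewrite (qmin _ sq' q'q) lerBrDr.
Qed.

(** * Small averages of a weakly null sequence *)

(** [h] vanishes on the integers, so [h (t *+ n) = h t *+ n] is the value of [h]
    at the fractional part of [t *+ n] and stays bounded as [n] grows. *)
Lemma additive_bounded_eq0 (R : realType) (h : R -> R) (C : R) :
  (forall s t, h (s + t) = h s + h t) -> h 1 = 0 ->
  (forall t, 0 <= t -> t <= 1 -> `|h t| <= C) -> forall t, h t = 0.
Proof.
move=> hD h1 hC.
have h0 : h 0 = 0 by have := hD 0 0; rewrite addr0; lra.
have hn t n : h (t *+ n) = h t *+ n.
  by elim: n => [|n ih]; rewrite ?mulr0n// mulrS hD ih mulrS.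
have h_pos t : 0 <= t -> h t = 0.
  move=> t0; apply/eqP; rewrite -normr_le0 leNgt; apply/negP => ht.
  have := truncnS_gt (C / `|h t|); set n := (Num.trunc _).+1.
  rewrite ltr_pdivrMr// mulrC mulr_natr -normrMn -hn; apply/negP; rewrite -leNgt.
  have /andP[mlt ltm] := truncn_itv (mulrn_wge0 n t0).
  set m := Num.trunc _ in mlt ltm.
  rewrite -[t *+ n](subrK m%:R) hD hn h1 mul0rn addr0 hC//.
    by rewrite subr_ge0.
  by rewrite lerBlDl natr1 ltW.
move=> t; have [/h_pos//|/ltW t0] := leP 0 t.
by have := hD t (- t); rewrite subrr h0 (h_pos (- t)) ?oppr_ge0//; lra.
Qed.

(** For fixed [x], the defect of homogeneity [t |-> f (t *: x) - t * f x] is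
    additive, bounded on the unit interval and zero at [1], hence zero. *)
Lemma additive_le_norm_dual (R : realType) (E : normedModType R) (f : E -> R) :
  (forall x y, f (x + y) = f x + f y) -> (forall x, f x <= `|x|) ->
  exists g : {linear E -> R^o}, continuous g /\ forall x, g x = f x.
Proof.
move=> fD fle.
have f0 : f 0 = 0 by have := fD 0 0; rewrite addr0; lra.
have fN x : f (- x) = - f x by have := fD x (- x); rewrite subrr f0; lra.
have fabs x : `|f x| <= `|x|.
  by rewrite ler_norml fle andbT -lerNl -fN (le_trans (fle _))// normrN.
have fZ t x : f (t *: x) = t * f x.
  apply/eqP; rewrite -subr_eq0; apply/eqP.
  pose h s := f (s *: x) - s * f x.
  apply: (@additive_bounded_eq0 _ h (`|x| + `|x|)) => [s s'||s s0 s1].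
  - by rewrite /h scalerDl fD; ring.
  - by rewrite /h scale1r mul1r subrr.
  rewrite /h (le_trans (ler_normB _ _))// lerD//.
    by rewrite (le_trans (fabs _))// normrZ (ger0_norm s0) ler_piMl.
  rewrite normrM (ger0_norm s0).
  by rewrite (le_trans _ (fabs x))// ler_piMl.
have fL : linear (f : E -> R^o) by move=> a x y; rewrite fD fZ.
pose g : {linear E -> R^o} :=
  HB.pack (f : E -> R^o) (GRing.isLinear.Build R E R^o *:%R f fL).
exists g; split=> //; apply: bounded_linear_continuous.
apply/linear_boundedP; near=> r => x; rewrite (le_trans (fabs x))// ler_peMl//.
Unshelve. all: by end_near.
Qed.

Lemma big_flatten_nseq (V : nmodType) (I : Type) (z : I -> V) (s : seq I) k :
  \sum_(i <- flatten (nseq k s)) z i = (\sum_(i <- s) z i) *+ k.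
Proof.
elim: k => [|k ih]; first by rewrite big_nil mulr0n.
by rewrite /= big_cat ih mulrS.
Qed.

Lemma size_flatten_nseq (I : Type) (s : seq I) k :
  size (flatten (nseq k s)) = (k * size s)%N.
Proof. by elim: k => //= k ih; rewrite size_cat ih mulSn. Qed.

(** If the conclusion fails then [p x], the infimum over [m > 0] and words [s] of
    [(`|x *+ m + \sum_(i <- s) z i| - d * size s) / m], is finite, sublinear,
    below the norm, and at most [- d] at each [- z n] (take [m = 1] and the word
    [n]).  An additive functional below [p] is therefore continuous, linear and
    at least [d] on the whole sequence [z]. *)
Lemma weakly_null_small_average (R : realType) (E : normedModType R)
    (z : nat -> E) (d : R) :
  weakly_cvg_to z 0 -> 0 < d ->
  exists s : seq nat, s != [::] /\ `|\sum_(i <- s) z i| < d * (size s)%:R.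
Proof.
move=> z0 d0; apply: contrapT => no.
have dle s : d * (size s)%:R <= `|\sum_(i <- s) z i|.
  case: s => [|i s]; first by rewrite mulr0 normr_ge0.
  by rewrite leNgt; apply/negP => lt; apply: no; exists (i :: s).
(* The first component encodes the positive integer [m = a.1.+1]. *)
pose g x (a : nat * seq nat) : R :=
  (`|x *+ a.1.+1 + \sum_(i <- a.2) z i| - d * (size a.2)%:R) / a.1.+1%:R.
have lb x a : - `|x| <= g x a.
  rewrite ler_pdivlMr ?ltr0n// mulNr [_ * _.+1%:R]mulr_natr -normrMn.
  have := dle a.2; have := lerB_normD (\sum_(i <- a.2) z i) (x *+ a.1.+1).
  by rewrite (addrC (\sum_(i <- a.2) z i)); lra.
pose p x := inf [set g x a | a in [set: nat * seq nat]].
have p_le x a : p x <= g x a by exact: (inf_image_le (fun a _ => lb x a)).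
have p_leM x m s : (0 < m)%N ->
    p x <= (`|x *+ m + \sum_(i <- s) z i| - d * (size s)%:R) / m%:R.
  by case: m => // m _; exact: (p_le x (m, s)).
have le_p x b : (forall a, b <= g x a) -> b <= p x.
  by move=> h; apply: (@le_inf_image _ _ _ (g x) b (0%N, [::])) => // a _.
have sp : group_sublinear p.
  split=> [x y|x k].
    rewrite -lerBlDr; apply: (le_p) => -[m s].
    rewrite lerBlDr [leRHS]addrC -lerBlDr.
    apply: (le_p) => -[n t]; rewrite lerBlDr.
    (* Reduce the fractions for [x] and [y] to the denominator [m.+1 * n.+1]. *)
    pose c := (flatten (nseq n.+1 s) ++ flatten (nseq m.+1 t)).
    apply: (le_trans (@p_leM _ (m.+1 * n.+1)%N c _)) => //.
    rewrite /g/= big_cat !big_flatten_nseq size_cat !size_flatten_nseq.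
    set S := \sum_(i <- s) z i; set T := \sum_(i <- t) z i.
    rewrite mulrnDl addrACA mulrnA -mulrnDl mulnC mulrnA -mulrnDl natrD !natrM.
    have m0 : 0 < m.+1%:R :> R by rewrite ltr0n.
    have n0 : 0 < n.+1%:R :> R by rewrite ltr0n.
    rewrite addf_div ?gt_eqF// ler_pM2r ?invr_gt0 ?mulr_gt0//.
    have := ler_normD ((x *+ m.+1 + S) *+ n.+1) ((y *+ n.+1 + T) *+ m.+1).
    rewrite !normrMn -![`|_| *+ _]mulr_natr; lra.
  apply: (le_p) => -[n s]; case: k => [|k].
    by rewrite !mulr0n; apply: le_trans (lb _ _); rewrite normr0 oppr0.
  have k0 : 0 < k.+1%:R :> R by rewrite ltr0n.
  rewrite -mulr_natr -ler_pdivlMr// (le_trans (@p_leM x (k.+1 * n.+1)%N s _))//.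
  by rewrite /g/= -mulrnA natrM invfM mulrA mulrAC.
have [f [fD fp]] := hahn_banach_group sp.
have p_norm x : p x <= `|x|.
  have := p_le x (0%N, [::]).
  by rewrite /g/= mulr1n big_nil addr0 mulr0 subr0 divr1.
have [F [Fc FE]] := additive_le_norm_dual fD (fun x => le_trans (fp x) (p_norm x)).
have fz n : d <= F (z n).
  have := fp (- z n); have := p_le (- z n) (0%N, [:: n]).
  rewrite /g/= mulr1n big_seq1 addNr normr0 mulr1 divr1 sub0r -FE raddfN => a b.
  by have := le_trans b a; rewrite lerN2.
have := z0 F Fc; rewrite raddf0 => /cvgr0_norm_lt /(_ _ d0)[n _].
move=> /(_ n (leqnn n))/=.
by rewrite ltNge (le_trans (fz n)) ?ler_norm.
Qed.

(** * Splicing periodic sequences *)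

(** The discrepancy is itself periodic in [N]. *)
Lemma periodic_bounded_discrepancy (R : realType) (E : normedModType R)
    (u : nat -> E) (m : nat) :
  (0 < m)%N -> (forall n, u (n + m)%N = u n) ->
  exists C : R, forall N,
    `|\sum_(n < N) (u n - m%:R^-1 *: \sum_(i < m) u i)| <= C.
Proof.
move=> m0 um; set a := _ *: _.
pose Q N := \sum_(n < N) (u n - a).
have Qm : Q m = 0.
  rewrite /Q sumrB sumr_const card_ord /a -scaler_nat scalerA mulfV ?scale1r ?subrr//.
  by rewrite pnatr_eq0 -lt0n.
have QDm N : Q (N + m)%N = Q N.
  elim: N => [|N ih]; first by rewrite add0n Qm /Q big_ord0.
  by rewrite addSn /Q !big_ord_recr/= -!/(Q _) ih um.
have Qmod N : Q N = Q (N %% m)%N.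
  rewrite {1}(divn_eq N m); elim: (N %/ m)%N => [|k ih]; first by rewrite mul0n.
  by rewrite mulSn -addnA addnC QDm.
exists (\sum_(r < m) `|Q r|) => N.
rewrite -/(Q N) Qmod (bigD1 (Ordinal (ltn_pmod N m0)))//= lerDl.
by apply: sumr_ge0.
Qed.

(** Waiting until [n] overtakes [k.+1%:R * D k.+1] is what yields
    [slow_index_le], and advancing by single steps keeps each switch between
    consecutive indices. *)
Fixpoint slow_index (R : realType) (D : nat -> R) (n : nat) : nat :=
  if n is n'.+1 then
    let k := slow_index D n' in
    if k.+1%:R * D k.+1 <= n'.+1%:R then k.+1 else k
  else 0.

Lemma slow_index_le (R : realType) (D : nat -> R) n :
  (slow_index D n)%:R * D (slow_index D n) <= n%:R.
Proof.
elim: n => [|n ih] /=; first by rewrite mul0r.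
by case: ifP => // _; rewrite (le_trans ih)// ler_nat.
Qed.

Lemma slow_index_cvgny (R : realType) (D : nat -> R) :
  slow_index D n @[n --> \oo] --> \oo.
Proof.
have mono m n : (m <= n)%N -> (slow_index D m <= slow_index D n)%N.
  move=> /subnK <-; elim: (n - m)%N => // d ih.
  by rewrite addSn; apply: (leq_trans ih) => /=; case: ifP.
suff unb k : exists n, (k <= slow_index D n)%N.
  apply/cvgnyPge => k; have [n kn] := unb k.
  by exists n => // n' /= nn'; exact: leq_trans kn (mono _ _ nn').
elim: k => [|k [n kn]]; first by exists 0%N.
have [//|stuck] := pselect (exists n, (k < slow_index D n)%N).
pose M := maxn n (Num.trunc (k.+1%:R * D k.+1)).+1.
exists M.+1; have kM : slow_index D M = k.
  apply/eqP; rewrite eqn_leq (leq_trans kn (mono _ _ (leq_maxl _ _))) andbT.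
  by rewrite leqNgt; apply/negP => lt; apply: stuck; exists M.
rewrite /= kM; case: ifPn => //; rewrite -ltNge => lt.
have := truncnS_gt (k.+1%:R * D k.+1); rewrite ltNge => /negP[].
by rewrite (le_trans _ (ltW lt))// ler_nat; apply/leqW/leq_maxr.
Qed.

(** Write [v (k n) n] as [a (k n)] plus a deviation.  The means of [a (k n)] tend
    to [0] by Cesaro's lemma.  As long as [k] is constant, equal to [j], the sum
    [G] of the deviations follows the discrepancy [Q j] up to a constant; hence
    [G N] is at most [D (k N)], twice the sum of the bounds [C j] for
    [j <= k N], whatever the switching times.  The slow growth of [k] makes this
    at most [N / k N]. *)
Lemma splice_cesaro_null (R : realType) (E : normedModType R)
    (v : nat -> nat -> E) (a : nat -> E) :
  a j @[j --> \oo] --> (0 : E) ->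
  (forall j, exists C : R, forall N, `|\sum_(n < N) (v j n - a j)| <= C) ->
  exists k : nat -> nat,
    N.+1%:R^-1 *: (\sum_(n < N.+1) v (k n) n) @[N --> \oo] --> (0 : E).
Proof.
move=> a0 /choice[C Cle].
pose Q j N := \sum_(n < N) (v j n - a j).
have C0 j : 0 <= C j by rewrite (le_trans _ (Cle j 0%N)).
pose D k : R := 2 * \sum_(j < k.+1) C j.
pose k := slow_index D; exists k.
have koo : k n @[n --> \oo] --> \oo by exact: slow_index_cvgny.
pose G N := \sum_(n < N) (v (k n) n - a (k n)).
(* Switching from [j] to [j.+1] changes [G N - Q (k N) N] by at most
   [C j + C j.+1]; the summand [C (k N)] keeps the cost [C j] paid in advance. *)
have GQ N : `|G N - Q (k N) N| + C (k N) <= D (k N).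
  elim: N => [|N ih].
    rewrite /G /Q !big_ord0 subrr normr0 add0r /D /= big_ord1.
    by have := C0 0%N; lra.
  have -> : G N.+1 - Q (k N.+1) N.+1 =
      (G N - Q (k N) N) + (Q (k N) N.+1 - Q (k N.+1) N.+1).
    rewrite {1}/G big_ord_recr/= -/(G N) {3}/Q big_ord_recr/= -/(Q (k N) N).
    by rewrite [RHS]addrA subrKA.
  have [kS|kS] : k N.+1 = k N \/ k N.+1 = (k N).+1.
  - by rewrite /k /=; case: ifP; [right|left].
  - by rewrite kS subrr addr0.
  rewrite kS /D big_ord_recr /= mulrDr -/(D _).
  have := ler_normD (G N - Q (k N) N) (Q (k N) N.+1 - Q (k N).+1 N.+1).
  have := ler_normB (Q (k N) N.+1) (Q (k N).+1 N.+1).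
  by have := Cle (k N) N.+1; have := Cle (k N).+1 N.+1; rewrite -!/(Q _ _); lra.
have GD N : `|G N| <= D (k N).
  have := ler_normD (G N - Q (k N) N) (Q (k N) N); rewrite subrK.
  by have := Cle (k N) N; rewrite -/(Q _ _); have := GQ N; lra.
have ak0 : arithmetic_mean (fun n => `|a (k n)|) N @[N --> \oo] --> (0 : R).
  apply: cesaro; have /cvg_norm := cvg_comp k a koo a0.
  by rewrite normr0.
have kS : k N.+1 @[N --> \oo] --> \oo by rewrite (cvg_shiftS k).
have kinv0 : (k N.+1)%:R^-1 @[N --> \oo] --> (0 : R).
  apply/gtr0_cvgV0; last by move/cvgrnyP: kS; exact.
  by near=> N; rewrite ltr0n; near: N; move/cvgnyPge: kS; exact.
apply/norm_cvg0P.
have bound0 : arithmetic_mean (fun n => `|a (k n)|) N + (k N.+1)%:R^-1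
    @[N --> \oo] --> (0 : R).
  by rewrite -[0]addr0; exact: cvgD.
apply: (@squeeze_cvgr _ _ _ _ (cst 0) _ _ _ _ _ bound0); last exact: cvg_cst.
near=> N; rewrite normr_ge0/=.
have kN : (0 < k N.+1)%N by near: N; move/cvgnyPge: kS; exact.
have -> : \sum_(n < N.+1) v (k n) n = \sum_(n < N.+1) a (k n) + G N.+1.
  by rewrite -big_split/=; apply: eq_bigr => i _; rewrite addrC subrK.
rewrite scalerDr (le_trans (ler_normD _ _))// !normrZ ger0_norm ?invr_ge0//.
apply: lerD.
  by rewrite /arithmetic_mean/= seriesEord/= ler_wpM2l ?invr_ge0// ler_norm_sum.
rewrite mulrC ler_pdivrMr ?ltr0n// mulrC ler_pdivlMr ?ltr0n//.
by rewrite (le_trans _ (slow_index_le D N.+1))// mulrC ler_wpM2l.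
Unshelve. all: by end_near.
Qed.

Theorem proposition2 (R : realType) (E : completeNormedModType R)
    (y : nat -> E) (l : E) (hy : weakly_cvg_to y l) :
  exists phi : nat -> nat,
    (forall n : nat, (1 <= n)%N -> (1 <= phi n)%N) /\
    cesaro_summable_to (fun n : nat => y (phi n)) l.
Proof.
pose z n := y n.+1 - l.
have z0 : weakly_cvg_to z 0.
  move=> f fc; rewrite raddf0 -(subrr (f l)).
  under eq_fun do rewrite raddfB.
  apply: cvgB; last exact: cvg_cst.
  by rewrite (cvg_shiftS (f \o y)); exact: hy.
have /choice[s hs] j : exists s : seq nat,
    s != [::] /\ `|\sum_(i <- s) z i| < j.+1%:R^-1 * (size s)%:R.
  exact: weakly_null_small_average.
have s_gt0 j : (0 < size (s j))%N by rewrite lt0n size_eq0 (hs j).1.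
pose w j n := nth 0%N (s j) (n %% size (s j)).
pose a j := (size (s j))%:R^-1 *: \sum_(i < size (s j)) z (w j i).
have a0 : a j @[j --> \oo] --> (0 : E).
  apply/norm_cvg0P.
  apply: (@squeeze_cvgr _ _ _ _ (cst 0) _ _ _ _ _ (@cvg_harmonic R));
    last exact: cvg_cst.
  apply: nearW => j; rewrite normr_ge0/= /a normrZ ger0_norm ?invr_ge0//.
  rewrite mulrC ler_pdivrMr ?ltr0n// (le_trans _ (ltW (hs j).2))//.
  rewrite [X in _ <= `|X|](big_nth 0%N) big_mkord le_eqVlt; apply/orP; left.
  by apply/eqP; congr (`|_|); apply: eq_bigr => i _; rewrite /w modn_small.
have [|k hk] := @splice_cesaro_null _ _ (fun j n => z (w j n)) a a0.
  move=> j; apply: (@periodic_bounded_discrepancy _ _ (fun n => z (w j n))) => // n.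
  by rewrite /w modnDr.
(* Both the times and the letters of the words are counted from [0]. *)
exists (fun n => (w (k n.-1) n.-1).+1); split=> //.
rewrite /cesaro_summable_to -cvg_shiftS.
have mean_z N : cesaro_mean (fun n => y (w (k n.-1) n.-1).+1) N.+1 =
    N.+1%:R^-1 *: (\sum_(n < N.+1) z (w (k n) n)) + l.
  rewrite /cesaro_mean big_add1/= big_mkord /z sumrB sumr_const card_ord.
  by rewrite scalerBr -[l *+ _]scaler_nat scalerA mulVf ?pnatr_eq0// scale1r subrK.
under eq_fun do rewrite mean_z.
have : N.+1%:R^-1 *: (\sum_(n < N.+1) z (w (k n) n)) + l @[N --> \oo] --> 0 + l.
  by apply: cvgD => //; exact: cvg_cst.
by rewrite add0r.
Qed.
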